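(* Let $\kappa\in\overline S$ and $\lambda\in\mathcal D^\sigma$ with $t_\lambda(\kappa)\in\{\mathtt{1i2s},\mathtt{1rn},\mathtt{2rn},\mathtt{3rn}\}$, and let $\gamma\in\mathcal D^\sigma$. According to the type $t_\gamma(\kappa)$, the following identities hold (no formula is claimed for the other types). If $\kappa\notin\tau(\gamma)$: - 1C+: $\widehat P(\gamma,\lambda)=-v\widehat P(w_\kappa\times\gamma,\lambda)+v\widehat U_\kappa(\gamma,\lambda)$. - 1i1: $\widehat P(\gamma,\lambda)+\widehat P(w_\kappa\times\gamma,\lambda)=-(v-v^{-1})\widehat P(\gamma^\kappa,\lambda)+v\widehat U_\kappa(\gamma,\lambda)$. - 1i2f: $\widehat P(\gamma,\lambda)=-\tfrac12(v-v^{-1})\big(\widehat P(\gamma^\kappa_1,\lambda)+\widehat P(\gamma^\kappa_2,\lambda)\big)+\tfrac12v\widehat U_\kappa(\gamma,\lambda)$. - 2C+: $\widehat P(\gamma,\lambda)=-v^2\widehat P(w_\kappa\times\gamma,\lambda)+v^2\widehat U_\kappa(\gamma,\lambda)$. - 2Ci: $(v+v^{-1})\widehat P(\gamma,\lambda)=-v(v-v^{-1})\widehat P(\gamma^\kappa,\lambda)+v\widehat U_\kappa(\gamma,\lambda)$. - 2i11: $\widehat P(\gamma,\lambda)+\widehat P(w_\kappa\times\gamma,\lambda)=-(v^2-v^{-2})\widehat P(\gamma^\kappa,\lambda)+v^2\widehat U_\kappa(\gamma,\lambda)$. - 2i12: $\widehat P(\gamma,\lambda)=-\tfrac12(v^2-v^{-2})\sum_{\gamma'\,:\,\gamma'\xrightarrow{\kappa}\gamma}\epsilon(\gamma',\gamma)\widehat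 P(\gamma',\lambda)+\tfrac12v^2\widehat U_\kappa(\gamma,\lambda)$. - 2i22: $\widehat P(\gamma,\lambda)=-\tfrac12(v^2-v^{-2})\big(\widehat P(\gamma^\kappa_1,\lambda)+\widehat P(\gamma^\kappa_2,\lambda)\big)+\tfrac12v^2\widehat U_\kappa(\gamma,\lambda)$. - 3C+: $\widehat P(\gamma,\lambda)=-v^3\widehat P(w_\kappa\times\gamma,\lambda)+v^3\widehat U_\kappa(\gamma,\lambda)$. - 3Ci, 3i: $(v+v^{-1})\widehat P(\gamma,\lambda)=-v(v^2-v^{-2})\widehat P(\gamma^\kappa,\lambda)+v^2\widehat U_\kappa(\gamma,\lambda)$. If $\kappa\in\tau(\gamma)$: - 1r1s, 1ic: $(v+v^{-1})\widehat P(\gamma,\lambda)=\widehat U_\kappa(\gamma,\lambda)$. - 2ic: $(v^2+v^{-2})\widehat P(\gamma,\lambda)=\widehat U_\kappa(\gamma,\lambda)$. - 3ic: $(v^3+v^{-3})\widehat P(\gamma,\lambda)=\widehat U_\kappa(\gamma,\lambda)$.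
   Context: Setting (Lusztig–Vogan). $G$ is a complex connected reductive group, $\theta$ a Cartan involution, $K=G^\theta$, $H\subset B$ a Cartan and a Borel subgroup, $(W,S)$ the Weyl group with its simple reflections. $\sigma$ is an automorphism of $G$ commuting with $\theta$, preserving $(B,H)$ and inducing an involution $\sigma$ of $(W,S)$. $\mathcal D$ is the finite set of irreducible $K$-equivariant local systems on $K$-orbits on $G/B$, with its length $\ell$, cross action $w\times\gamma$ of $W$, and (possibly multivalued) Cayley transforms $\gamma^\alpha$ (noncompact imaginary $\alpha$), $\gamma_\alpha$ (real parity $\alpha$). $\mathcal D^\sigma$ is the set of $\sigma$-fixed elements. $\overline S$ is the set of $\sigma$-orbits on $S$. For $\kappa=\{s_\alpha\}$ or $\{s_\alpha,s_\beta\}$ ($\beta=\sigma\alpha$), $w_\kappa$ is the longest element of the group generated by $\kappa$ and $\ell(\kappa)=\ell(w_\kappa)$: it is $1$ if $\sigma\alpha=\alpha$, $2$ if $\alpha\neq\beta$ are orthogonal, $3$ if $\langle\alpha,\beta^\vee\rangle=-1$. Types. For $\gamma\in\mathcal D^\sigma$, $\kappa\in\overline S$ the type $t_\gamma(\kappa)$ (leading digit $k=\ell(\kappa)$) is one of: Ascents ($\kappa\notin\tau(\gamma)$): 1C+, 1i1, 1i2f, 1i2s, 1rn; 2C+, 2Ci, 2i11, 2i12, 2i22, 2rn; 3C+, 3Ci, 3i, 3rn. Descents ($\kappa\in\tau(\gamma)$): 1C-, 1r1f, 1r1s, 1r2, 1ic; 2C-, 2Cr, 2r11, 2r21, 2r22,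 2ic; 3C-, 3Cr, 3r, 3ic. $\tau(\gamma)$ is the set of descents. Here C$\pm$: $\alpha$ (and $\beta$) complex, $\pm\theta\alpha>0$, $\theta\alpha\ne\pm\beta$ if $k>1$; Ci: $\theta\alpha=\beta$; Cr: $\theta\alpha=-\beta$; ic: compact imaginary; rn: real not satisfying the parity condition; the remaining i- (resp. r-) types: noncompact imaginary (resp. real parity). 1i1: type 1; 1i2f, 1i2s: type 2 with $\sigma$ fixing, resp. switching, the two values of $\gamma^\alpha$; 1r1f, 1r1s: type 1 with $\sigma$ fixing, resp. switching, the two values of $\gamma_\alpha$; 1r2: type 2; 2i11, 2i12, 2i22: $(\gamma^\alpha)^\beta$ has $1,2,4$ values; 2r22, 2r21, 2r11: $(\gamma_\alpha)_\beta$ has $1,2,4$ values. The $\kappa$-Cayley transforms are: $\gamma^\kappa=\gamma^\alpha$, $\gamma_\kappa=\gamma_\alpha$ for 1i1,1i2f,1r1f,1r2; $\gamma^\kappa=(\gamma^\alpha)^\beta$, $\gamma_\kappa=(\gamma_\alpha)_\beta$ for 2i11,2i12,2r22,2r21, and the two $\sigma$-fixed elements of these sets for 2i22, 2r11; $s_\alpha\times\gamma=s_\beta\times\gamma$ for 2Ci ($\gamma^\kappa$) and 2Cr ($\gamma_\kappa$); $\gamma^\kappa=(s_\alpha\times\gamma)^\beta\cap(s_\beta\times\gamma)^\alpha$ for 3Ci and $\gamma_\kappa=(s_\alpha\times\gamma)_\beta\cap(s_\beta\times\gamma)_\alpha$ for 3Cr; $\gamma^\kappa=s_\alpha\times\gamma^\beta=s_\beta\times\gamma^\alpha$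 for 3i and $\gamma_\kappa=s_\alpha\times\gamma_\beta=s_\beta\times\gamma_\alpha$ for 3r. Two values are denoted $\gamma^\kappa_1,\gamma^\kappa_2$ or $\gamma_\kappa^1,\gamma_\kappa^2$. Up- and down-transforms are mutually inverse relations, matching 1i1/1r1f, 1i2f/1r2, 2Ci/2Cr, 2i11/2r11, 2i12/2r21, 2i22/2r22, 3Ci/3Cr, 3i/3r; in types 1r2, 2r22 the parameters $\gamma\neq w_\kappa\times\gamma$ have the same type and the same $\gamma_\kappa$; in types 1i1, 2i11 the parameters $\gamma\ne w_\kappa\times\gamma$ have the same type and the same $\gamma^\kappa$; $w_\kappa\times$ exchanges $k$C+ and $k$C-. Module. $u=v^2$. $M$ is the Lusztig–Vogan module, free over $\mathbb Z[v,v^{-1}]$ with basis $a_\gamma$ ($\gamma\in\mathcal D^\sigma$), for the Hecke algebra generated by the $T_{w_\kappa}$ with $(T_{w_\kappa}+1)(T_{w_\kappa}-u^{\ell(\kappa)})=0$. Standing assumption: extensions of parameters have been chosen so that, with $k=\ell(\kappa)$, $T_{w_\kappa}a_\gamma$ equals $k$C+: $a_{w_\kappa\times\gamma}$; $k$C-: $(u^k-1)a_\gamma+u^ka_{w_\kappa\times\gamma}$; 1i1, 2i11: $a_{w_\kappa\times\gamma}+a_{\gamma^\kappa}$; 1i2f, 2i22: $a_\gamma+a_{\gamma^\kappa_1}+a_{\gamma^\kappa_2}$; 2i12: $a_\gamma+\sum_{\gamma'\xrightarrow{\kappa}\gamma}\epsilon(\gamma',\gamma)a_{\gamma'}$; 2Ci,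 3Ci, 3i: $ua_\gamma+(u+1)a_{\gamma^\kappa}$; 1i2s, 1rn, 2rn, 3rn: $-a_\gamma$; 1ic, 2ic, 3ic, 1r1s: $u^ka_\gamma$; 1r1f, 2r11: $(u^k-2)a_\gamma+(u^k-1)(a_{\gamma_\kappa^1}+a_{\gamma_\kappa^2})$; 1r2, 2r22: $(u^k-1)a_\gamma-a_{w_\kappa\times\gamma}+(u^k-1)a_{\gamma_\kappa}$; 2r21: $(u^2-2)a_\gamma+(u^2-1)\sum_{\gamma\xrightarrow{\kappa}\gamma'}\epsilon(\gamma,\gamma')a_{\gamma'}$; 2Cr, 3Cr, 3r: $(u^k-u-1)a_\gamma+(u^k-u)a_{\gamma_\kappa}$. Arrows: $\gamma\xrightarrow{\kappa}\lambda$ means $\kappa\in\tau(\gamma)$, $\kappa\notin\tau(\lambda)$ and $a_\lambda$ appears in $T_{w_\kappa}a_\gamma$. Signs: for $\gamma\xrightarrow{\kappa}\lambda$, $\epsilon(\gamma,\lambda)=1$ unless $t_\gamma(\kappa)=$ 2r21; in that case $\gamma$ belongs to an ordered pair $(\gamma_1,\gamma_2)$ with $\{\gamma_1,\gamma_2\}=\{\gamma,s_\alpha\times\gamma\}$, $\lambda$ to an ordered pair $(\lambda_1,\lambda_2)$ of 2i12 parameters whose underlying set is the common Cayley transform of $\gamma_1,\gamma_2$ (chosen orderings), and $\epsilon(\gamma_i,\lambda_j)=-1$ if $i=j=2$ and $1$ otherwise. Defect: $\mathrm{def}_\gamma(\kappa)=1$ if $t_\gamma(\kappa)\in\{$2Ci,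 3Ci, 3i, 2Cr, 3Cr, 3r$\}$, else $0$; if $\gamma\xrightarrow{\kappa}\lambda$ then $\ell(\gamma)-\ell(\lambda)=\ell(\kappa)-\mathrm{def}_\gamma(\kappa)$ and $\mathrm{def}_\lambda(\kappa)=\mathrm{def}_\gamma(\kappa)$. Normalizations: $\hat a_\gamma=v^{-\ell(\gamma)}a_\gamma$, $\widehat T_\kappa=v^{-\ell(\kappa)}(T_{w_\kappa}+1)$. Canonical basis (Lusztig–Vogan, recalled). $\mathcal D^\sigma$ has a partial order $\le$ with $\gamma<\delta\Rightarrow\ell(\gamma)<\ell(\delta)$. $M$ has a canonical additive involution $\mathbf D$, semilinear for $v\mapsto v^{-1}$, commuting with every $\widehat T_\kappa$, and a unique basis $\widehat C_\delta=\sum_\gamma\widehat P(\gamma,\delta)\hat a_\gamma$ ($\delta\in\mathcal D^\sigma$) with $\mathbf D\widehat C_\delta=\widehat C_\delta$, $\widehat P(\gamma,\delta)\neq0\Rightarrow\gamma\le\delta$, $\widehat P(\delta,\delta)=1$, $\widehat P(\gamma,\delta)\in v^{-1}\mathbb Z[v^{-1}]$ for $\gamma\ne\delta$; moreover $\widehat P(\gamma,\delta)=v^{\ell(\gamma)-\ell(\delta)}P(\gamma,\delta)(v^2)$ with $P(\gamma,\delta)$ an integer polynomial. Also $\kappa\in\tau(\lambda)$ iff $\widehat T_\kappa\widehat C_\lambda=(v^{\ell(\kappa)}+v^{-\ell(\kappa)})\widehat C_\lambda$. For $\kappa\notin\tau(\lambda)$ there are unique $m_\kappa(\gamma,\lambda)\in\mathbb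 Z[v,v^{-1}]$, invariant under $v\mapsto v^{-1}$, with $\widehat T_\kappa\widehat C_\lambda=\sum_{\gamma:\kappa\in\tau(\gamma)}m_\kappa(\gamma,\lambda)\widehat C_\gamma$. $\mu_{-1}(\gamma,\delta)$ is the coefficient of $v^{-1}$ in $\widehat P(\gamma,\delta)$. For $\kappa\in\tau(\delta)$, $\kappa\notin\tau(\lambda)$ write $\delta\overset{\kappa}{\prec}\lambda$ if one of the following holds: (b) $\delta<\lambda$; (c) $\mathrm{def}_\delta(\kappa)=1$, $\delta\not<\lambda$ and $\mu_{-1}(\delta_\kappa,\lambda)\ne0$; (c$'$) $\mathrm{def}_\lambda(\kappa)=1$, $\delta\not<\lambda$ and $\mu_{-1}(\delta,\lambda^\kappa)\neq0$. For $\kappa\notin\tau(\lambda)$ set $\widehat U_\kappa(\gamma,\lambda)=\sum_{\delta:\,\kappa\in\tau(\delta),\ \delta\overset{\kappa}{\prec}\lambda}\widehat P(\gamma,\delta)\,m_\kappa(\delta,\lambda)$. *)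

(* Defs.v *)
From HB Require Import structures.
From mathcomp Require Import all_boot all_order all_algebra all_fingroup.
From mathcomp Require Import boolp zify.

Set Implicit Arguments.
Unset Strict Implicit.
Unset Printing Implicit Defensive.

Import Order.TTheory GRing.Theory Num.Theory.
Local Open Scope ring_scope.

(* Z[v,v^-1] is realised as the subring of Q(v) = Frac Z[v] consisting of the
   v^-n p(v); identities with a coefficient 1/2 are read in Q(v). *)
Definition Qv : fieldType := {fraction {poly int}}.

Definition vQ : Qv := tofrac ('X : {poly int}).

Definition is_laurent (x : Qv) : Prop :=
  exists n : nat, exists p : {poly int}, x * vQ ^+ n = tofrac p.

Definition laurent_pred : {pred Qv} := fun x => `[< is_laurent x >].

Lemma laurentP (x : Qv) : reflect (is_laurent x) (x \in laurent_pred).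
Proof. exact: asboolP. Qed.

Lemma vQX n : vQ ^+ n = tofrac ('X^n : {poly int}).
Proof. by rewrite /vQ -rmorphXn. Qed.

Lemma vQ_neq0 : vQ != 0.
Proof. by rewrite /vQ tofrac_eq0 polyX_eq0. Qed.

Lemma laurent_subring : subring_closed laurent_pred.
Proof.
split=> [|x y /laurentP[n [p px]] /laurentP[m [q qy]]
         |x y /laurentP[n [p px]] /laurentP[m [q qy]]]; apply/laurentP.
- by exists 0, 1; rewrite expr0 mulr1 tofrac1.
- exists (n + m)%N, (p * 'X^m - q * 'X^n).
  rewrite tofracB !tofracM -px -qy -!vQX mulrBl.
  by rewrite [X in _ - _ * vQ ^+ X]addnC !exprD !mulrA.
- exists (n + m)%N, (p * q).
  by rewrite tofracM -px -qy exprD !mulrA (mulrAC x).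
Qed.

HB.instance Definition _ :=
  GRing.isSubringClosed.Build Qv laurent_pred laurent_subring.

Record laurent := Laurent {lval :> Qv; _ : lval \in laurent_pred}.

HB.instance Definition _ := [isSub for lval].
HB.instance Definition _ := [Choice of laurent by <:].
HB.instance Definition _ := [SubChoice_isSubComNzRing of laurent by <:].

Fact lval_is_zmod_morphism : zmod_morphism lval.
Proof. exact: (@rmorphB laurent Qv \val). Qed.

Fact lval_is_monoid_morphism : monoid_morphism lval.
Proof.
by split; [exact: (@rmorph1 laurent Qv \val) | exact: (@rmorphM laurent Qv \val)].
Qed.

HB.instance Definition _ :=
  GRing.isZmodMorphism.Build laurent Qv lval lval_is_zmod_morphism.
HB.instance Definition _ :=
  GRing.isMonoidMorphism.Build laurent Qv lval lval_is_monoid_morphism.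

Lemma laurent_vX (z : int) : vQ ^ z \in laurent_pred.
Proof.
apply/laurentP; case: z => n.
  by exists 0, 'X^n; rewrite expr0 mulr1 -vQX.
by exists n.+1, 1; rewrite tofrac1 mulVf // expf_neq0 // vQ_neq0.
Qed.

(* the monomial v^z, and u = v^2 *)
Definition vX (z : int) : laurent := Laurent (laurent_vX z).
Definition u : laurent := vX 2.

Lemma laurent_rep (x : laurent) :
  exists np : nat * {poly int}, lval x * vQ ^+ np.1 = tofrac np.2.
Proof. by have /laurentP[n [p px]] := valP x; exists (n, p). Qed.

Definition lrep (x : laurent) : nat * {poly int} := projT1 (cid (laurent_rep x)).

(* the coefficient of v^j *)
Definition lcoef (x : laurent) (j : int) : int :=
  let: (n, p) := lrep x in
  if (j + n%:Z)%R is Posz i then p`_i else 0.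

(* the ring involution v |-> v^-1 *)
Definition bar (x : laurent) : laurent :=
  let: (n, p) := lrep x in
  \sum_(i < size p) vX (n%:Z - i%:Z) *~ p`_i.

(* [lcoef] does not depend on the representation chosen by [lrep] *)
Lemma lcoefE (x : laurent) (n : nat) (p : {poly int}) (j : int) :
  lval x * vQ ^+ n = tofrac p ->
  lcoef x j = if (j + n%:Z)%R is Posz i then p`_i else 0.
Proof.
rewrite /lcoef /lrep; case: cid => [[m q]] /= mq np.
have pq : p * 'X^m = q * 'X^n.
  by apply/eqP; rewrite -tofrac_eq !tofracM -np -mq -!vQX mulrAC.
have lt0 a b : (a + b < b)%N = false by rewrite ltnNge leq_addl.
have E k : (p * 'X^m)`_k = (q * 'X^n)`_k by rewrite pq.
case jm: (j + m%:Z) => [a|a]; case jn: (j + n%:Z) => [b|b] //=.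
- have := E (a + n)%N; rewrite !coefMXn lt0 addnK.
  suff -> : (a + n = b + m)%N by rewrite lt0 addnK.
  by apply/eqP; rewrite -eqz_nat !PoszD -jm -jn addrAC.
- have := E (a + n)%N; rewrite !coefMXn lt0 addnK.
  suff -> : (a + n < m)%N by [].
  by rewrite -ltz_nat PoszD -jm addrAC jn gtrDr.
- have := E (b + m)%N; rewrite !coefMXn lt0 addnK.
  suff -> : (b + m < n)%N by [].
  by rewrite -ltz_nat PoszD -jn addrAC jm gtrDr.
Qed.

Lemma lcoef_bar (x : laurent) (j : int) : lcoef (bar x) j = lcoef x (- j).
Proof.
rewrite [RHS]/lcoef /bar /lrep; case: cid => [[n p]] /= _.
pose s := size p.
pose q : {poly int} := \sum_(i < s) p`_i *: 'X^(n + (s - i)).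
have Eq : lval (\sum_(i < s) vX (n%:Z - i%:Z) *~ p`_i) * vQ ^+ s = tofrac q.
  have -> : lval (\sum_(i < s) vX (n%:Z - i%:Z) *~ p`_i)
      = \sum_(i < s) vQ ^ (n%:Z - i%:Z) *~ p`_i.
    by rewrite (raddf_sum lval); apply: eq_bigr => i _; rewrite raddfMz.
  rewrite /q rmorph_sum mulr_suml; apply: eq_bigr => i _ /=.
  rewrite -[p`_i in RHS]intz scaler_int rmorphMz /= -vQX mulrzAl; congr (_ *~ _).
  rewrite !exprnP -expfzDr ?vQ_neq0 //; congr (_ ^ _).
  by have := ltn_ord i; lia.
rewrite (lcoefE _ Eq) -/s.
have qE k : (k <= n + s)%N -> q`_k = p`_(n + s - k).
  move=> kns; rewrite /q coef_sum; under eq_bigr => i _ do rewrite coefZ coefXn.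
  have [le|lt] := leqP s (n + s - k)%N.
    rewrite [RHS]nth_default // big1 // => i _; case: eqP => e; rewrite ?mulr0 //.
    by have := ltn_ord i; move: le e; lia.
  rewrite (bigD1 (Ordinal lt)) //= big1 => [|i /eqP ne].
    case: eqP => [|e]; rewrite ?mulr1 ?addr0 //.
    by move: lt kns e; rewrite -/s; lia.
  case: eqP => e; rewrite ?mulr0 //; case: ne; apply: val_inj => /=.
  by have := ltn_ord i; lia.
have q0 k : (n + s < k)%N -> q`_k = 0.
  move=> kns; rewrite /q coef_sum big1 // => i _; rewrite coefZ coefXn.
  by case: eqP => e; rewrite ?mulr0 //; have := ltn_ord i; lia.
case e1: (j + s%:Z) => [k|k]; case e2: (- j + n%:Z) => [l|l].
- by rewrite qE; [congr (_`_ _)|]; lia.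
- by rewrite q0 //; lia.
- by rewrite nth_default // -/s; lia.
- by [].
Qed.

(* [rroot] indexes the roots; [vec] and [covec] give the roots and coroots as
   characters and cocharacters of H. *)
Definition rd_pair (root : Type) (n : nat) (vec covec : root -> 'rV[int]_n)
  (a b : root) : int := (vec a *m (covec b)^T) 0 0.

Record rootDatum := RootDatum {
  rd_rank : nat;
  rroot : finType;
  vec : rroot -> 'rV[int]_rd_rank;
  covec : rroot -> 'rV[int]_rd_rank;
  refl : rroot -> {perm rroot};
  simple : {set rroot};
  pos : {set rroot};
  vec_inj : injective vec;
  pair_root_coroot : forall a, rd_pair vec covec a a = 2;
  vec_refl : forall a b,
    vec (refl a b) = vec b - vec a *~ rd_pair vec covec b a;
  covec_refl : forall a b,
    covec (refl a b) = covec b - covec a *~ rd_pair vec covec a b;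
  root_reduced : forall a b, vec b <> vec a *+ 2;
  simple_pos : simple \subset pos;
  simple_free : forall c : rroot -> int,
    \sum_(a in simple) vec a *~ c a = 0 -> forall a, a \in simple -> c a = 0;
  pos_span : forall b, b \in pos ->
    exists c : rroot -> nat, vec b = \sum_(a in simple) vec a *+ c a;
  neg_span : forall b, b \notin pos ->
    exists c : rroot -> nat, - vec b = \sum_(a in simple) vec a *+ c a }.

(* the root - a *)
Definition ropp (RD : rootDatum) (a : rroot RD) : rroot RD := refl a a.

(* The permutation f of the roots is induced by an automorphism of the root
   datum. *)
Definition rd_aut (RD : rootDatum) (f : {perm rroot RD}) : Prop :=
  exists2 A : 'M[int]_(rd_rank RD), A \in unitmx &
    forall a, vec (f a) = vec a *m A /\ covec a = covec (f a) *m A^T.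

(* The parabolic subgroup generated by the reflections in A, and W.
   In {perm _} the product w2 * w1 is the composite "w1 after w2". *)
Definition refl_group (RD : rootDatum) (A : {set rroot RD}) :
  {group {perm rroot RD}} := <<[set refl a | a in A]>>%G.
Definition weyl (RD : rootDatum) := refl_group (simple RD).

Definition wlen (RD : rootDatum) (w : {perm rroot RD}) : nat :=
  #|[set a in pos RD | w a \notin pos RD]|.

Definition longest (RD : rootDatum) (A : {set rroot RD}) : {perm rroot RD} :=
  [arg max_(w > (1%g : {perm rroot RD}) in refl_group A) wlen w].

(* TkX is the type kX, with p and m for + and -. *)
Inductive lvtype :=
  | T1Cp | T1i1 | T1i2f | T1i2s | T1rn
  | T2Cp | T2Ci | T2i11 | T2i12 | T2i22 | T2rn
  | T3Cp | T3Ci | T3i | T3rn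
  | T1Cm | T1r1f | T1r1s | T1r2 | T1ic
  | T2Cm | T2Cr | T2r11 | T2r21 | T2r22 | T2ic
  | T3Cm | T3Cr | T3r | T3ic.

Definition tdigit (t : lvtype) : nat :=
  match t with
  | T1Cp | T1i1 | T1i2f | T1i2s | T1rn | T1Cm | T1r1f | T1r1s | T1r2 | T1ic => 1
  | T2Cp | T2Ci | T2i11 | T2i12 | T2i22 | T2rn
  | T2Cm | T2Cr | T2r11 | T2r21 | T2r22 | T2ic => 2
  | T3Cp | T3Ci | T3i | T3rn | T3Cm | T3Cr | T3r | T3ic => 3
  end.

Definition tdescent (t : lvtype) : bool :=
  match t with
  | T1Cm | T1r1f | T1r1s | T1r2 | T1ic | T2Cm | T2Cr | T2r11 | T2r21 | T2r22
  | T2ic | T3Cm | T3Cr | T3r | T3ic => true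
  | _ => false
  end.

Definition tdefect (t : lvtype) : nat :=
  match t with
  | T2Ci | T3Ci | T3i | T2Cr | T3Cr | T3r => 1
  | _ => 0
  end.

(* Possible types of a parameter and of its up-transforms. With theta_delta =
   s_{alpha+beta} theta_gamma, up-transforms of 3i (resp. 3Ci) parameters have
   type 3Cr (resp. 3r). The types 3Ci, 3i, and likewise 3Cr, 3r, obey the same
   formulas, so no matching inside these two classes is imposed. *)
Definition tmatch (t t' : lvtype) : bool :=
  match t, t' with
  | T1i1, T1r1f | T1i2f, T1r2 | T2Ci, T2Cr | T2i11, T2r11 | T2i12, T2r21
  | T2i22, T2r22 | (T3Ci | T3i), (T3Cr | T3r) => true
  | _, _ => false
  end.

Definition tcross (t : lvtype) : lvtype :=
  match t with
  | T1Cp => T1Cm | T1Cm => T1Cp | T2Cp => T2Cm | T2Cm => T2Cp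
  | T3Cp => T3Cm | T3Cm => T3Cp
  | t => t
  end.

(* number of kappa-Cayley transforms, up for ascents and down for descents *)
Definition tvalues (t : lvtype) : nat :=
  match t with
  | T1i1 | T2Ci | T2i11 | T3Ci | T3i | T1r2 | T2Cr | T2r22 | T3Cr | T3r => 1
  | T1i2f | T2i12 | T2i22 | T1r1f | T2r11 | T2r21 => 2
  | _ => 0
  end.

(* The set of irreducible K-equivariant local systems on K-orbits on G/B enters
   through its combinatorial structure only; G, B, H enter through RD. *)
Record lvData (RD : rootDatum) := LvData {
  sgR : {perm rroot RD};
  param : finType;
  sgD : {perm param};
  plen : param -> nat;
  cross : action (weyl RD) param;
  (* the involution of the roots defined by theta at gamma *)
  theta : param -> {perm rroot RD};
  (* compactness of imaginary roots, parity condition for real roots *)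
  cpt : param -> pred (rroot RD);
  parity : param -> pred (rroot RD);
  (* the set of values of gamma^alpha, and of gamma_alpha; by convention empty
     when the transform is not defined *)
  up : param -> rroot RD -> {set param};
  dn : param -> rroot RD -> {set param};
  sgR_aut : rd_aut sgR;
  sgR_simple : forall a, (sgR a \in simple RD) = (a \in simple RD);
  sgR_invol : forall a, a \in simple RD -> sgR (sgR a) = a;
  theta_aut : forall g, rd_aut (theta g);
  theta_invol : forall g a, theta g (theta g a) = a;
  theta_cross : forall g w, w \in weyl RD ->
    theta (cross g w) = (theta g ^ w)%g;
  up_dom : forall g a, a \in simple RD ->
    (up g a != set0) = (theta g a == a) && ~~ cpt g a;
  dn_dom : forall g a, a \in simple RD ->
    (dn g a != set0) = (theta g a == ropp a) && parity g a;
  up_dn : forall g d a, a \in simple RD -> (d \in up g a) = (g \in dn d a);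
  sg_cross : forall g w, w \in weyl RD ->
    sgD (cross g w) = cross (sgD g) (w ^ sgR)%g;
  sg_theta : forall g, theta (sgD g) = (theta g ^ sgR)%g;
  sg_cpt : forall g a, cpt (sgD g) (sgR a) = cpt g a;
  sg_parity : forall g a, parity (sgD g) (sgR a) = parity g a;
  sg_up : forall g a, a \in simple RD -> up (sgD g) (sgR a) = sgD @: up g a;
  sg_dn : forall g a, a \in simple RD -> dn (sgD g) (sgR a) = sgD @: dn g a }.

Section LvDataDefs.
Variables (RD : rootDatum) (LD : lvData RD).
Implicit Types (g : param LD) (a : rroot RD) (t : lvtype).

(* the sigma-orbits of simple roots (equivalently of simple reflections) *)
Definition sorbits : {set {set rroot RD}} :=
  [set [set a; sgR LD a] | a in simple RD].
Definition sbar := {K : {set rroot RD} | K \in sorbits}.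

(* the set of sigma-fixed parameters *)
Definition fixparam := {g : param LD | sgD LD g == g}.

Definition wK (K : sbar) : {perm rroot RD} := longest (val K).
Definition ellK (K : sbar) : nat := wlen (wK K).

Definition scross a g : param LD := cross LD g (refl a).

Definition complex_at g a := (theta g a != a) && (theta g a != ropp a).
Definition nci_at g a := (theta g a == a) && ~~ cpt g a.
Definition rp_at g a := (theta g a == ropp a) && parity g a.

(* (gamma^alpha)^beta and (gamma_alpha)_beta *)
Definition up2 g a b : {set param LD} := \bigcup_(d in up g a) up d b.
Definition dn2 g a b : {set param LD} := \bigcup_(d in dn g a) dn d b.

Definition type_at g a t : bool :=
  let b := sgR LD a in
  match t with
  | T1Cp => complex_at g a && (theta g a \in pos RD)
  | T1Cm => complex_at g a && (theta g a \notin pos RD)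
  | T2Cp | T3Cp =>
      [&& complex_at g a, theta g a \in pos RD, theta g a != b &
          theta g a != ropp b]
  | T2Cm | T3Cm =>
      [&& complex_at g a, theta g a \notin pos RD, theta g a != b &
          theta g a != ropp b]
  | T2Ci | T3Ci => theta g a == b
  | T2Cr | T3Cr => theta g a == ropp b
  | T1ic | T2ic | T3ic => (theta g a == a) && cpt g a
  | T1rn | T2rn | T3rn => (theta g a == ropp a) && ~~ parity g a
  | T1i1 => nci_at g a && (#|up g a| == 1%N)
  | T1i2f => [&& nci_at g a, #|up g a| == 2%N &
                 [forall d in up g a, sgD LD d == d]]
  | T1i2s => [&& nci_at g a, #|up g a| == 2%N &
                 [forall d in up g a, sgD LD d != d]]
  | T2i11 => nci_at g a && (#|up2 g a b| == 1%N)
  | T2i12 => nci_at g a && (#|up2 g a b| == 2%N)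
  | T2i22 => nci_at g a && (#|up2 g a b| == 4%N)
  | T3i => nci_at g a
  | T1r1f => [&& rp_at g a, #|dn g a| == 2%N &
                 [forall d in dn g a, sgD LD d == d]]
  | T1r1s => [&& rp_at g a, #|dn g a| == 2%N &
                 [forall d in dn g a, sgD LD d != d]]
  | T1r2 => rp_at g a && (#|dn g a| == 1%N)
  | T2r22 => rp_at g a && (#|dn2 g a b| == 1%N)
  | T2r21 => rp_at g a && (#|dn2 g a b| == 2%N)
  | T2r11 => rp_at g a && (#|dn2 g a b| == 4%N)
  | T3r => rp_at g a
  end.

(* No root is selected in kappa: the description has to hold for every
   numbering {alpha, beta} of kappa. *)
Definition has_type (K : sbar) (g : fixparam) t : bool :=
  (ellK K == tdigit t) && [forall a in val K, type_at (val g) a t].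

Definition up_at t g a : {set param LD} :=
  let b := sgR LD a in
  match t with
  | T1i1 | T1i2f => up g a
  | T2i11 | T2i12 | T2i22 => up2 g a b
  | T2Ci => [set scross a g]
  | T3Ci => up (scross a g) b :&: up (scross b g) a
  | T3i => [set scross a d | d in up g b]
  | _ => set0
  end.

Definition dn_at t g a : {set param LD} :=
  let b := sgR LD a in
  match t with
  | T1r1f | T1r2 => dn g a
  | T2r22 | T2r21 | T2r11 => dn2 g a b
  | T2Cr => [set scross a g]
  | T3Cr => dn (scross a g) b :&: dn (scross b g) a
  | T3r => [set scross a d | d in dn g b]
  | _ => set0
  end.

(* The sets of sigma-fixed values of the kappa-Cayley transforms of a parameter
   of type t; again for every numbering of kappa. *)
Definition up_type t (K : sbar) (g : fixparam) : {set fixparam} :=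
  [set d : fixparam | [forall a in val K, val d \in up_at t (val g) a]].
Definition dn_type t (K : sbar) (g : fixparam) : {set fixparam} :=
  [set d : fixparam | [forall a in val K, val d \in dn_at t (val g) a]].

(* w_kappa x gamma; the default value of [insubd] is never used, see
   [crossK_fix] below *)
Definition crossK (K : sbar) (g : fixparam) : fixparam :=
  insubd g (cross LD (val g) (wK K)).

End LvDataDefs.

Record lvTypes (RD : rootDatum) (LD : lvData RD) := LvTypes {
  typ : sbar LD -> fixparam LD -> lvtype;
  typP : forall K g, has_type K g (typ K g);
  crossK_fix : forall (K : sbar LD) (g : fixparam LD),
    sgD LD (cross LD (val g) (wK K)) = cross LD (val g) (wK K);
  crossK_invol : forall (K : sbar LD) g, crossK K (crossK K g) = g;
  cross_C : forall K g,
    match typ K g with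
    | T1Cp | T1Cm | T2Cp | T2Cm | T3Cp | T3Cm =>
        typ K (crossK K g) = tcross (typ K g)
    | _ => True
    end;
  cross_i1 : forall K g,
    match typ K g with
    | T1i1 | T2i11 =>
        [/\ crossK K g != g, typ K (crossK K g) = typ K g &
            up_type (typ K g) K (crossK K g) = up_type (typ K g) K g]
    | _ => True
    end;
  cross_r2 : forall K g,
    match typ K g with
    | T1r2 | T2r22 =>
        [/\ crossK K g != g, typ K (crossK K g) = typ K g &
            dn_type (typ K g) K (crossK K g) = dn_type (typ K g) K g]
    | _ => True
    end;
  card_cayley : forall K g,
    #|up_type (typ K g) K g| + #|dn_type (typ K g) K g| = tvalues (typ K g);
  cayley_inv : forall K g d,
    (d \in up_type (typ K g) K g) = (g \in dn_type (typ K d) K d);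
  cayley_typ : forall K g d,
    d \in up_type (typ K g) K g -> tmatch (typ K g) (typ K d);
  (* [pr K g] is the ordered pair to which g belongs, when g has type 2r21 or
     2i12 *)
  pr : sbar LD -> fixparam LD -> fixparam LD * fixparam LD;
  pr_r21 : forall K g, typ K g = T2r21 ->
    [/\ (pr K g).1 != (pr K g).2,
        forall a, a \in val K ->
          [set val (pr K g).1; val (pr K g).2] = [set val g; scross a (val g)] &
        forall g', g' \in [set (pr K g).1; (pr K g).2] ->
          [/\ typ K g' = T2r21, pr K g' = pr K g &
              dn_type T2r21 K g' = dn_type T2r21 K g]];
  pr_i12 : forall K g, typ K g = T2r21 ->
    exists l : fixparam LD * fixparam LD,
      dn_type T2r21 K g = [set l.1; l.2] /\
      forall d, d \in dn_type T2r21 K g -> pr K d = l }.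

Section LvTypesDefs.
Variables (RD : rootDatum) (LD : lvData RD) (LT : lvTypes LD).
Implicit Types (K : sbar LD) (g d : fixparam LD).

(* kappa belongs to tau(gamma) *)
Definition desc K g : bool := tdescent (typ LT K g).
Definition defect K g : nat := tdefect (typ LT K g).

(* the sets of values of gamma^kappa and gamma_kappa *)
Definition upK K g : {set fixparam LD} := up_type (typ LT K g) K g.
Definition dnK K g : {set fixparam LD} := dn_type (typ LT K g) K g.

Definition is_r21 K g : bool := if typ LT K g is T2r21 then true else false.

Definition eps K g d : laurent :=
  if [&& is_r21 K g, g == (pr LT K g).2 & d == (pr LT K d).2] then -1 else 1.

Definition ellP g : nat := plen (val g).

End LvTypesDefs.

(* the free Z[v,v^-1]-module on the sigma-fixed parameters, with its basis *)
Definition lvmod (RD : rootDatum) (LD : lvData RD) : lmodType laurent :=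
  {ffun fixparam LD -> laurent^o}.

Definition abas (RD : rootDatum) (LD : lvData RD) (g : fixparam LD) : lvmod LD :=
  [ffun d => (d == g)%:R].

(* f g f g ... (n factors) applied to x *)
Fixpoint alternate (V : Type) (n : nat) (f g : V -> V) (x : V) : V :=
  if n is m.+1 then f (alternate m g f x) else x.

Section Arrow.
Variables (RD : rootDatum) (LD : lvData RD) (LT : lvTypes LD).
Variable T : sbar LD -> lvmod LD -> lvmod LD.

Definition arrow (K : sbar LD) (g d : fixparam LD) : bool :=
  [&& desc LT K g, ~~ desc LT K d & T K (abas g) d != 0].

(* The value prescribed for T_{w_kappa} a_gamma; single-valued Cayley
   transforms are also written as sums over their set of values. For 2r21 the
   sum is over gamma_kappa, since "gamma' appears in T_{w_kappa} a_gamma" would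
   be circular there. *)
Definition T_value (K : sbar LD) (g : fixparam LD) : lvmod LD :=
  let k := ellK K in
  let a := @abas RD LD in
  let g' := crossK K g in
  match typ LT K g with
  | T1Cp | T2Cp | T3Cp => a g'
  | T1Cm | T2Cm | T3Cm => (u ^+ k - 1) *: a g + u ^+ k *: a g'
  | T1i1 | T2i11 => a g' + \sum_(d in upK LT K g) a d
  | T1i2f | T2i22 => a g + \sum_(d in upK LT K g) a d
  | T2i12 => a g + \sum_(d | arrow K d g) eps LT K d g *: a d
  | T2Ci | T3Ci | T3i => u *: a g + (u + 1) *: \sum_(d in upK LT K g) a d
  | T1i2s | T1rn | T2rn | T3rn => - a g
  | T1ic | T2ic | T3ic | T1r1s => u ^+ k *: a g
  | T1r1f | T2r11 =>
      (u ^+ k - 2) *: a g + (u ^+ k - 1) *: \sum_(d in dnK LT K g) a d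
  | T1r2 | T2r22 =>
      (u ^+ k - 1) *: a g - a g' + (u ^+ k - 1) *: \sum_(d in dnK LT K g) a d
  | T2r21 =>
      (u ^+ 2 - 2) *: a g +
      (u ^+ 2 - 1) *: \sum_(d in dnK LT K g) eps LT K g d *: a d
  | T2Cr | T3Cr | T3r =>
      (u ^+ k - u - 1) *: a g + (u ^+ k - u) *: \sum_(d in dnK LT K g) a d
  end.

End Arrow.

(* T K is the action of T_{w_kappa}; signs of the extended parameters are those
   for which [T_abas] holds. *)
Record lvModule (RD : rootDatum) (LD : lvData RD) (LT : lvTypes LD) := LvModule {
  T : sbar LD -> {linear lvmod LD -> lvmod LD};
  T_abas : forall K g, T K (abas g) = T_value LT T K g;
  T_quadratic : forall K x,
    T K (T K x - u ^+ ellK K *: x) + (T K x - u ^+ ellK K *: x) = 0;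
  T_braid : forall (K K' : sbar LD) x,
    let m := #[wK K * wK K']%g in
    alternate m (T K) (T K') x = alternate m (T K') (T K) x;
  arrow_length : forall K g d, arrow LT T K g d ->
    (ellP g)%:Z - (ellP d)%:Z = (ellK K)%:Z - (defect LT K g)%:Z;
  arrow_defect : forall K g d, arrow LT T K g d ->
    defect LT K d = defect LT K g }.

Section LvModuleDefs.
Variables (RD : rootDatum) (LD : lvData RD) (LT : lvTypes LD).
Variable LM : lvModule LT.

Definition ahat (g : fixparam LD) : lvmod LD := vX (- (ellP g)%:Z) *: abas g.

Definition That (K : sbar LD) (x : lvmod LD) : lvmod LD :=
  vX (- (ellK K)%:Z) *: (T LM K x + x).

End LvModuleDefs.

Definition neg_laurent (x : laurent) : Prop :=
  forall j : int, (0 <= j)%R -> lcoef x j = 0.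

Record lvCanonical (RD : rootDatum) (LD : lvData RD) (LT : lvTypes LD)
    (LM : lvModule LT) := LvCanonical {
  ple : rel (fixparam LD);
  ple_refl : reflexive ple;
  ple_anti : antisymmetric ple;
  ple_trans : transitive ple;
  ple_len : forall g d, ple g d -> g != d -> (ellP g < ellP d)%N;
  Dinv : lvmod LD -> lvmod LD;
  Dinv_add : forall x y, Dinv (x + y) = Dinv x + Dinv y;
  Dinv_semilin : forall c x, Dinv (c *: x) = bar c *: Dinv x;
  Dinv_invol : forall x, Dinv (Dinv x) = x;
  Dinv_That : forall K x, Dinv (That LM K x) = That LM K (Dinv x);
  Phat : fixparam LD -> fixparam LD -> laurent;
  Chat : fixparam LD -> lvmod LD;
  ChatE : forall d, Chat d = \sum_g Phat g d *: ahat g;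
  Chat_selfdual : forall d, Dinv (Chat d) = Chat d;
  Phat_le : forall g d, Phat g d != 0 -> ple g d;
  Phat_diag : forall d, Phat d d = 1;
  Phat_neg : forall g d, g != d -> neg_laurent (Phat g d);
  Ppol : fixparam LD -> fixparam LD -> {poly int};
  PhatE : forall g d, lval (Phat g d) =
    vQ ^ ((ellP g)%:Z - (ellP d)%:Z) * tofrac (Ppol g d \Po 'X^2);
  desc_Chat : forall K l, desc LT K l <->
    That LM K (Chat l) = (vX (ellK K) + vX (- (ellK K)%:Z)) *: Chat l;
  mK : sbar LD -> fixparam LD -> fixparam LD -> laurent;
  mK_bar : forall K g l, ~~ desc LT K l -> desc LT K g ->
    bar (mK K g l) = mK K g l;
  mKE : forall K l, ~~ desc LT K l ->
    That LM K (Chat l) = \sum_(g | desc LT K g) mK K g l *: Chat g }.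

Section LvCanonicalDefs.
Variables (RD : rootDatum) (LD : lvData RD) (LT : lvTypes LD).
Variables (LM : lvModule LT) (LC : lvCanonical LM).
Implicit Types (K : sbar LD) (g d l : fixparam LD).

Definition mu1 g d : int := lcoef (Phat LC g d) (-1).

Definition plt g d : bool := (g != d) && ple LC g d.

Definition prec K d l : bool :=
  [|| plt d l,
      [&& defect LT K d == 1%N, ~~ plt d l &
          [exists d' in dnK LT K d, mu1 d' l != 0]] |
      [&& defect LT K l == 1%N, ~~ plt d l &
          [exists l' in upK LT K l, mu1 d l' != 0]]].

Definition Uhat K g l : laurent :=
  \sum_(d | desc LT K d && prec K d l) Phat LC g d * mK LC K d l.

End LvCanonicalDefs.

(* Main.v *)
Require Import Defs.
From HB Require Import structures.
From mathcomp Require Import all_boot all_order all_algebra all_fingroup.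
From mathcomp Require Import zify ring.

Set Implicit Arguments.
Unset Strict Implicit.
Unset Printing Implicit Defensive.

Import Order.TTheory GRing.Theory Num.Theory.
Local Open Scope ring_scope.

(** Write That C_l = sum m(d,l) C_d over the descents d, and take the
    coefficient of ahat_g on both sides.

    On the left, the coefficient is a combination of the P(e,l) for those e such
    that a_g occurs in T a_e: besides g itself these are w x g and the Cayley
    transforms of g, because the up and down transforms are inverse relations
    and w x is an involution ([acoef_That], through the row formula [entry_row]
    and its transpose [hentryE]). Each identity of the theorem is this
    combination, cleared of denominators, provided that the right hand side is
    Uhat(g,l).

    The right hand side is sum P(g,d) m(d,l) over all descents d, whereas Uhat
    only keeps the d with d prec l. So the point is that m(d,l) = 0 for the
    other descents d ([mK_prec]). If d is not below l, the coefficient of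
    ahat_d reads m(d,l) + sum P(d,e) m(e,l) = h(d) ([hatT_Chat]), where the e
    with a nonzero term are longer than d and, by transitivity, not below l
    either. As P(d,l) = 0 and a_d does not occur in T a_l = - a_l, h(d) only
    involves P(e,l) with e <> l, hence has no power v^j with j >= 0; the
    exception is defect 1, where the factor v + v^-1 creates a constant term
    mu_{-1}(d_kappa,l) ([hatT_descent_coef]). By downward induction on the
    length, m(d,l) has the same coefficients as h(d) in degrees j >= 0
    ([mK_nonneg]). Being invariant under v |-> v^-1, it is then that constant,
    and d prec l as soon as mu_{-1}(d_kappa,l) is nonzero. *)

(** * Laurent polynomials *)

Lemma lval_inj : injective lval.
Proof. exact: val_inj. Qed.

(** Instances of the morphism laws that keep [lval] as head symbol, so that they
    combine with the rules for the values of monomials. *)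
Lemma lval0 : lval 0 = 0. Proof. exact: (rmorph0 lval). Qed.
Lemma lval1 : lval 1 = 1. Proof. exact: (rmorph1 lval). Qed.
Lemma lvalD x y : lval (x + y) = lval x + lval y.
Proof. exact: (rmorphD lval). Qed.
Lemma lvalN x : lval (- x) = - lval x.
Proof. exact: (rmorphN lval). Qed.
Lemma lvalM x y : lval (x * y) = lval x * lval y.
Proof. exact: (rmorphM lval). Qed.
Lemma lvalX x n : lval (x ^+ n) = lval x ^+ n.
Proof. exact: (rmorphXn lval). Qed.
Definition lvalE := (lval0, lval1, lvalD, lvalN, lvalM, lvalX).

Lemma vXD a b : vX (a + b) = vX a * vX b.
Proof. by apply: lval_inj; rewrite rmorphM /= expfzDr ?vQ_neq0. Qed.

Lemma vX0 : vX 0 = 1.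
Proof. by apply: lval_inj; rewrite rmorph1 /= expr0z. Qed.

Lemma vXE n : vX n%:Z = vX 1 ^+ n.
Proof.
elim: n => [|n IHn]; first by rewrite vX0 expr0.
by rewrite exprS -IHn -vXD; congr (vX _); lia.
Qed.

Lemma u_exp n : u ^+ n = vX (2 * n)%N%:Z.
Proof. by rewrite vXE exprM; congr (_ ^+ n); rewrite /u vXE. Qed.

Lemma vX_inj : injective vX.
Proof.
have nat_inj (k : nat) : vX k%:Z = vX 0 -> k = 0%N.
  move/(congr1 lval) => /= /eqP.
  rewrite -exprnP expr0z vQX -tofrac1 tofrac_eq => /eqP.
  move/(congr1 (size : {poly int} -> nat)).
  by rewrite size_polyXn size_poly1 => -[].
move=> a b ab; wlog le_ab : a b ab / b <= a.
  by move=> H; case: (lerP b a) => [|/ltW] le; [exact: H | exact/esym/H].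
have E : vX `|a - b|%:Z = vX 0.
  rewrite (_ : `|a - b|%:Z = a - b); last by lia.
  by rewrite (vXD a) ab -vXD subrr.
by have := nat_inj _ E; lia.
Qed.

Lemma vX_sub_neq0 a b : a != b -> vX a - vX b != 0.
Proof. by rewrite subr_eq0; apply: contraNneq => /vX_inj ->. Qed.

Lemma vX_neq0 z : vX z != 0.
Proof.
apply/eqP => z0; have := oner_neq0 laurent.
by rewrite -vX0 -(subrr z) vXD z0 mul0r eqxx.
Qed.

Lemma lval_vXN n : lval (vX (- n%:Z)) = vQ ^- n.
Proof. by rewrite /= exprnN. Qed.

Lemma lval_u : lval u = vQ ^+ 2.
Proof. by []. Qed.

Lemma lval_is (x : laurent) : is_laurent (lval x).
Proof. exact/laurentP/(valP x). Qed.

Lemma lcoefD x y j : lcoef (x + y) j = lcoef x j + lcoef y j.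
Proof.
have [n [p px]] := lval_is x; have [m [q qy]] := lval_is y.
have px' : lval x * vQ ^+ (n + m) = tofrac (p * 'X^m).
  by rewrite exprD mulrA px tofracM vQX.
have qy' : lval y * vQ ^+ (n + m) = tofrac (q * 'X^n).
  by rewrite addnC exprD mulrA qy tofracM vQX.
have E : lval (x + y) * vQ ^+ (n + m) = tofrac (p * 'X^m + q * 'X^n).
  by rewrite rmorphD mulrDl px' qy' tofracD.
rewrite (lcoefE _ px') (lcoefE _ qy') (lcoefE _ E).
by case: (j + _) => k; rewrite ?addr0 // coefD.
Qed.

Lemma lcoef0 j : lcoef 0 j = 0.
Proof. by apply: (addrI (lcoef 0 j)); rewrite -lcoefD !addr0. Qed.

Lemma lcoefN x j : lcoef (- x) j = - lcoef x j.
Proof. by apply: (addrI (lcoef x j)); rewrite -lcoefD !subrr lcoef0. Qed.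

Lemma lcoef_sum (I : finType) (A : pred I) (F : I -> laurent) j :
  lcoef (\sum_(i | A i) F i) j = \sum_(i | A i) lcoef (F i) j.
Proof. exact: (big_morph (lcoef^~ j) (fun x y => lcoefD x y j) (lcoef0 j)). Qed.

Lemma lcoef_vXM z x j : lcoef (vX z * x) j = lcoef x (j - z).
Proof.
have [n [p px]] := lval_is x.
(* Shifting by |z| on top of n keeps the exponent z + |z| of 'X nonnegative. *)
have E : lval (vX z * x) * vQ ^+ (n + `|z|) = tofrac (p * 'X^(`|z + `|z| |)).
  rewrite rmorphM /= tofracM -vQX -px addnC exprD mulrACA mulrC; congr (_ * _).
  by rewrite !exprnP -expfzDr ?vQ_neq0 //; congr (_ ^ _); lia.
rewrite (lcoefE _ px) (lcoefE _ E).
case e1: (j + _) => [a|a]; case e2: (j - z + _) => [b|b] //; rewrite ?coefMXn.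
- by case: ltnP => ?; [lia | congr (_`_ _); lia].
- by case: ltnP => // ?; lia.
- lia.
Qed.

Lemma lcoef_eq0 x : (forall j, lcoef x j = 0) -> x = 0.
Proof.
move=> x0; have [n [p px]] := lval_is x.
suff p0 : p = 0.
  apply: lval_inj; move/eqP: px; rewrite p0 tofrac0 mulf_eq0 expf_eq0.
  by rewrite (negPf vQ_neq0) andbF orbF rmorph0 => /eqP.
apply/polyP => i; rewrite coef0.
by have := x0 (i%:Z - n%:Z); rewrite (lcoefE _ px) subrK.
Qed.

Lemma laurent_expand x :
  exists n s, x = \sum_(i < s) vX (i%:Z - n%:Z) *~ lcoef x (i%:Z - n%:Z).
Proof.
have [n [p px]] := lval_is x; exists n, (size p).
apply: lval_inj; apply: (mulIf (expf_neq0 n vQ_neq0)); rewrite px.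
rewrite (raddf_sum lval) mulr_suml -{1}[p]coefK poly_def rmorph_sum.
apply: eq_bigr => i _ /=; rewrite (lcoefE _ px) subrK.
rewrite -[in LHS](intz p`_i) scaler_int rmorphMz /= -vQX.
rewrite raddfMz /= mulrzAl; congr (_ *~ _).
by rewrite !exprnP -expfzDr ?vQ_neq0 // subrK.
Qed.

Definition nonpos_laurent (x : laurent) : Prop :=
  forall j : int, (0 < j)%R -> lcoef x j = 0.

Lemma neg_laurentD x y : neg_laurent x -> neg_laurent y -> neg_laurent (x + y).
Proof. by move=> xn yn j j0; rewrite lcoefD xn // yn // addr0. Qed.

Lemma neg_laurentN x : neg_laurent x -> neg_laurent (- x).
Proof. by move=> xn j j0; rewrite lcoefN xn // oppr0. Qed.

Lemma neg_laurent0 : neg_laurent 0.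
Proof. by move=> j _; exact: lcoef0. Qed.

Lemma neg_laurent_sum (I : finType) (A : pred I) (F : I -> laurent) :
  (forall i, A i -> neg_laurent (F i)) -> neg_laurent (\sum_(i | A i) F i).
Proof.
by move=> Fn; elim/big_ind: _ => //; [exact: neg_laurent0|exact: neg_laurentD].
Qed.

Lemma neg_laurent_vXM z x : z <= 0 -> neg_laurent x -> neg_laurent (vX z * x).
Proof. by move=> z0 xn j j0; rewrite lcoef_vXM xn //; lia. Qed.

Lemma neg_laurentMz x (n : int) : neg_laurent x -> neg_laurent (x *~ n).
Proof.
have natP k : neg_laurent x -> neg_laurent (x *+ k).
  move=> xn; elim: k => [|k IHk]; first exact: neg_laurent0.
  by rewrite mulrS; exact: neg_laurentD.
by case: n => k xn; [exact: natP | exact/neg_laurentN/natP].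
Qed.

Lemma neg_laurentM x y :
  neg_laurent x -> nonpos_laurent y -> neg_laurent (x * y).
Proof.
move=> xn yn.
(* Multiplying x by a monomial v^i with i <= 0 keeps its degrees negative. *)
have [n [s ->]] := laurent_expand y.
rewrite mulr_sumr; apply: neg_laurent_sum => i _.
have [lt|le] := ltrP 0 (i%:Z - n%:Z).
  by rewrite yn // mulr0z mulr0; exact: neg_laurent0.
rewrite mulrC mulrzAl; exact/neg_laurentMz/neg_laurent_vXM.
Qed.

(** Bar-invariance turns the vanishing of the positive coefficients into that
    of the negative ones. *)
Lemma bar_nonpos_eq0 x :
  bar x = x -> nonpos_laurent x -> lcoef x 0 = 0 -> x = 0.
Proof.
move=> bx xn x0; apply: lcoef_eq0 => j.
case: (ltrgtP j 0) => [j0|j0|->//]; last exact: xn.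
by rewrite -bx lcoef_bar xn // oppr_gt0.
Qed.

(** * The matrix of T on the basis a *)

(** [cdiag t], [ccross t], [cup t] and [cdn t] are the coefficients of a_d,
    a_(w x d), the up-transforms and the down-transforms in T a_d when d has
    type t. Tabulated this way, T a_d has one formula for all types, and the
    matrix can be transposed one term at a time. *)
Definition cdiag (t : lvtype) : laurent :=
  let q := u ^+ tdigit t in
  match t with
  | T1i2f | T2i22 | T2i12 => 1
  | T2Ci | T3Ci | T3i => u
  | T1i2s | T1rn | T2rn | T3rn => -1
  | T1Cm | T2Cm | T3Cm | T1r2 | T2r22 => q - 1
  | T1ic | T2ic | T3ic | T1r1s => q
  | T1r1f | T2r11 | T2r21 => q - 2
  | T2Cr | T3Cr | T3r => q - u - 1
  | T1Cp | T2Cp | T3Cp | T1i1 | T2i11 => 0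
  end.

Definition tcrosses (t : lvtype) : bool :=
  match t with
  | T1Cp | T2Cp | T3Cp | T1Cm | T2Cm | T3Cm | T1i1 | T2i11 | T1r2 | T2r22 =>
      true
  | _ => false
  end.

Definition ccross (t : lvtype) : laurent :=
  match t with
  | T1Cp | T2Cp | T3Cp | T1i1 | T2i11 => 1
  | T1Cm | T2Cm | T3Cm => u ^+ tdigit t
  | T1r2 | T2r22 => -1
  | _ => 0
  end.

Definition cup (t : lvtype) : laurent :=
  match t with
  | T1i1 | T1i2f | T2i11 | T2i12 | T2i22 => 1
  | T2Ci | T3Ci | T3i => u + 1
  | _ => 0
  end.

Definition cdn (t : lvtype) : laurent :=
  let q := u ^+ tdigit t in
  match t with
  | T1r1f | T1r2 | T2r11 | T2r21 | T2r22 => q - 1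
  | T2Cr | T3Cr | T3r => q - u
  | _ => 0
  end.

Section Matrix.
Variables (RD : rootDatum) (LD : lvData RD) (LT : lvTypes LD).
Variable LM : lvModule LT.
Implicit Types (K : sbar LD) (g d : fixparam LD).

Definition acoef (x : lvmod LD) (d : fixparam LD) : laurent :=
  (x : {ffun fixparam LD -> laurent^o}) d.

Lemma acoefD x y d : acoef (x + y) d = acoef x d + acoef y d.
Proof. by rewrite /acoef ffunE. Qed.

Lemma acoefN x d : acoef (- x) d = - acoef x d.
Proof. by rewrite /acoef ffunE. Qed.

Lemma acoefZ c x d : acoef (c *: x) d = c * acoef x d.
Proof. by rewrite /acoef ffunE. Qed.

Lemma acoef0 d : acoef 0 d = 0.
Proof. by rewrite /acoef ffunE. Qed.

Lemma acoef_sum (I : finType) (A : pred I) (F : I -> lvmod LD) d :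
  acoef (\sum_(i | A i) F i) d = \sum_(i | A i) acoef (F i) d.
Proof.
exact: (big_morph (acoef^~ d) (fun x y => acoefD x y d) (acoef0 d)).
Qed.

Lemma acoef_abas g d : acoef (abas g) d = (d == g)%:R.
Proof. by rewrite /acoef ffunE. Qed.

Lemma acoef_sum_abas (A : {pred fixparam LD}) (c : fixparam LD -> laurent) d :
  acoef (\sum_(e in A) c e *: abas e) d = c d * (d \in A)%:R.
Proof.
rewrite acoef_sum; under eq_bigr => e _ do rewrite acoefZ acoef_abas.
case: (boolP (d \in A)) => dA; last first.
  rewrite mulr0 big1 // => e eA; case: eqP => [ed|_]; last by rewrite mulr0.
  by rewrite ed eA in dA.
rewrite (bigD1 d) //= eqxx big1 ?addr0 // => e /andP[_ /negPf].
by rewrite eq_sym => ->; rewrite mulr0.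
Qed.

Lemma acoef_sum_abas1 (A : {pred fixparam LD}) d :
  acoef (\sum_(e in A) abas e) d = (d \in A)%:R.
Proof.
rewrite -[RHS]mul1r -(acoef_sum_abas A (fun=> 1)).
by under [in RHS]eq_bigr => e _ do rewrite scale1r.
Qed.

Lemma ellK_typ K g : ellK K = tdigit (typ LT K g).
Proof. by have /andP[/eqP] := typP LT K g. Qed.

Lemma sbar_inhab K : exists a, a \in val K.
Proof.
have /imsetP[a _ ->] := valP K; exists a; exact: set21.
Qed.

Lemma typ_crossK K g :
  tcrosses (typ LT K g) -> typ LT K (crossK K g) = tcross (typ LT K g).
Proof.
move: (cross_C LT K g) (cross_i1 LT K g) (cross_r2 LT K g).
by case: (typ LT K g) => //= H1 H2 H3 _;
  first [exact: H1 | by case: H2 | by case: H3].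
Qed.

Lemma eq_crossK K g d : (g == crossK K d) = (d == crossK K g).
Proof.
by apply/eqP/eqP => ->; rewrite (crossK_invol LT).
Qed.

Lemma mem_upK K g d : (d \in upK LT K g) = (g \in dnK LT K d).
Proof. exact: cayley_inv. Qed.

Lemma upK_match K g d :
  d \in upK LT K g -> tmatch (typ LT K g) (typ LT K d).
Proof. exact: cayley_typ. Qed.

Lemma eps_not_r21 K g d : typ LT K g <> T2r21 -> eps LT K g d = 1.
Proof. by rewrite /eps /is_r21; case: (typ LT K g). Qed.

Definition entry K d g := acoef (T LM K (abas d)) g.

Definition row_entry K d g : laurent :=
  let t := typ LT K d in
  cdiag t * (g == d)%:R + ccross t * (g == crossK K d)%:R
  + cup t * (eps LT K g d * (g \in upK LT K d)%:R)
  + cdn t * (eps LT K d g * (g \in dnK LT K d)%:R).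

Lemma epsM K d g (x : laurent) : typ LT K d <> T2r21 -> eps LT K d g * x = x.
Proof. by move=> /eps_not_r21 ->; rewrite mul1r. Qed.

(** A sign on an arrow from g to d is nontrivial only if g has type 2r21,
   hence d has type 2i12. *)
Lemma epsM_up K d g :
  typ LT K d <> T2i12 ->
  eps LT K g d * (g \in upK LT K d)%:R = (g \in upK LT K d)%:R.
Proof.
move=> nd; case: (boolP (g \in _)) => [/upK_match|_]; last by rewrite mulr0.
move=> m; rewrite eps_not_r21 ?mul1r // => E; move: m; rewrite E.
by case: (typ LT K d) nd.
Qed.

(** The value prescribed for 2i12 sums over arrows, which are themselves
    defined by entries of T. The other types come first; they cover all
    descents, so they determine the arrows. *)
Lemma entry_row_neq K d g : typ LT K d <> T2i12 ->
  entry K d g = row_entry K d g.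
Proof.
rewrite /entry /row_entry (T_abas LM) /T_value (ellK_typ K d) => n12.
have e1 := epsM_up g n12; have e2 := @epsM K d g (g \in dnK LT K d)%:R.
case E: (typ LT K d) n12 e1 e2 => //= _ e1 {}e2;
 rewrite ?(acoefD, acoefN, acoefZ, acoef_abas, acoef_sum_abas1, acoef_sum_abas)
   ?e1 //; try (rewrite e2; last by []); by ring.
Qed.

(** The entry of T at a Cayley transform is +-(u^k - 1) or +-(u^k - u), hence
    nonzero: the lengths and defects of Cayley transforms can be read off from
    [arrow_length] and [arrow_defect]. *)
Lemma arrow_dnK K g d : d \in dnK LT K g -> arrow LT (T LM) K g d.
Proof.
move=> dg; have gd := dg; rewrite -mem_upK in gd; have m := upK_match gd.
rewrite /arrow /desc; apply/and3P; split.
- by case: (typ LT K d) (typ LT K g) m => [] // [].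
- by case: (typ LT K d) (typ LT K g) m => [] // [].
have n12 : typ LT K g <> T2i12.
  by move=> E; move: m; rewrite E; case: (typ LT K d).
have := entry_row_neq d n12; rewrite /entry /row_entry dg.
have -> : (d == g) = false.
  by apply/eqP => E; move: m; rewrite E; case: (typ LT K g).
have -> : ccross (typ LT K g) * (d == crossK K g)%:R = 0.
  case: eqP => E; rewrite ?mulr0 // mulr1.
  case: (boolP (tcrosses (typ LT K g))) => [c|]; last by case: (typ LT K g).
  move: m; rewrite E typ_crossK //; by case: (typ LT K g).
have -> : (d \in upK LT K g) = false.
  apply/negP => /upK_match; by case: (typ LT K d) (typ LT K g) m => [] // [].
rewrite !mulr0 !add0r mulr1 => E; apply/eqP => E0.
have {E} := etrans (esym E) E0.
move/eqP; apply/negP.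
have -> x y : x * eps LT K g y != 0 = (x != 0).
  by rewrite /eps; case: ifP; rewrite ?mulrN1 ?mulr1 ?oppr_eq0.
case: (typ LT K d) (typ LT K g) m => [] // [] //= _;
  rewrite ?u_exp -?vX0; exact: vX_sub_neq0.
Qed.

Lemma arrow_i12 K g d : typ LT K d = T2i12 ->
  arrow LT (T LM) K g d = (g \in upK LT K d).
Proof.
move=> E; apply/idP/idP => [|gd]; last by rewrite arrow_dnK // -mem_upK.
case/and3P => dg _; rewrite mem_upK; apply: contraNT => ndg.
have n12 : typ LT K g <> T2i12 by move=> E'; move: dg; rewrite /desc E'.
change (entry K g d == 0); rewrite (entry_row_neq d n12) /row_entry (negPf ndg).
have -> : (d == g) = false.
  by apply/eqP => dE; move: dg; rewrite /desc -dE E.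
have -> : ccross (typ LT K g) * (d == crossK K g)%:R = 0.
  case: eqP => dE; rewrite ?mulr0 // mulr1.
  case: (boolP (tcrosses (typ LT K g))) => [c|]; last by case: (typ LT K g).
  by move: E; rewrite dE typ_crossK //; move: c; case: (typ LT K g).
have -> : cup (typ LT K g) = 0 by move: dg; rewrite /desc; case: (typ LT K g).
by rewrite !mulr0 mul0r !addr0.
Qed.

Lemma entry_row K d g : entry K d g = row_entry K d g.
Proof.
have [E|] : typ LT K d = T2i12 \/ typ LT K d <> T2i12.
  by case: (typ LT K d); by [left | right].
2: exact: entry_row_neq.
rewrite /entry /row_entry (T_abas LM) /T_value E /=.
rewrite (eq_bigl (mem (upK LT K d))); last by move=> e; exact: arrow_i12.
rewrite acoefD acoef_abas acoef_sum_abas; by ring.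
Qed.

Lemma len_upK K g d : d \in upK LT K g ->
  (ellP d)%:Z - (ellP g)%:Z
    = (tdigit (typ LT K g))%:Z - (tdefect (typ LT K g))%:Z.
Proof.
move=> dg; have a : arrow LT (T LM) K d g by rewrite arrow_dnK // -mem_upK.
by rewrite (arrow_length a) -(arrow_defect a) (ellK_typ K g).
Qed.

Definition is_Cm t := match t with T1Cm | T2Cm | T3Cm => true | _ => false end.

Lemma len_Cm K g : is_Cm (typ LT K g) ->
  (ellP g)%:Z - (ellP (crossK K g))%:Z = (tdigit (typ LT K g))%:Z.
Proof.
move=> t; have c : tcrosses (typ LT K g) by case: (typ LT K g) t.
have tc := typ_crossK c.
have a : arrow LT (T LM) K g (crossK K g).
  apply/and3P; rewrite /desc tc; split; try by case: (typ LT K g) t.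
  change (entry K g (crossK K g) != 0); rewrite entry_row /row_entry eqxx.
  have -> : (crossK K g == g) = false.
    by apply/eqP => E; move: tc t; rewrite E; case: (typ LT K g).
  have -> : cup (typ LT K g) = 0 by case: (typ LT K g) t.
  have -> : cdn (typ LT K g) = 0 by case: (typ LT K g) t.
  rewrite mulr0 !mul0r add0r !addr0 mulr1.
  by case: (typ LT K g) t => //= _; rewrite u_exp; apply: vX_neq0.
rewrite (arrow_length a) (ellK_typ K g) /defect.
by case: (typ LT K g) t => // _; rewrite subr0.
Qed.

(** In these types g and w x g have the same Cayley transform, and each of
    them differs in length from it by k. *)
Lemma len_same K g :
  match typ LT K g with T1i1 | T2i11 | T1r2 | T2r22 => True | _ => False end ->
  ellP (crossK K g) = ellP g.
Proof.
have [a aK] := sbar_inhab K.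
have no_up t : match t with T1r2 | T2r22 => True | _ => False end ->
    #|up_type t K g| = 0%N.
  case: t => // _; apply/eqP; rewrite cards_eq0 -subset0; apply/subsetP => e;
  by rewrite inE => /forall_inP/(_ _ aK); rewrite inE.
have no_dn t : match t with T1i1 | T2i11 => True | _ => False end ->
    #|dn_type t K g| = 0%N.
  case: t => // _; apply/eqP; rewrite cards_eq0 -subset0; apply/subsetP => e;
  by rewrite inE => /forall_inP/(_ _ aK); rewrite inE.
have up_case : match typ LT K g with T1i1 | T2i11 => True | _ => False end ->
    ellP (crossK K g) = ellP g.
  move=> t; have := card_cayley LT K g; rewrite (no_dn _ t) addr0.
  have -> : tvalues (typ LT K g) = 1%N by case: (typ LT K g) t.
  move/eqP/cards1P => [d Ed].
  have dg : d \in upK LT K g by rewrite /upK Ed set11.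
  have dg' : d \in upK LT K (crossK K g).
    rewrite /upK; have := cross_i1 LT K g.
    by case: (typ LT K g) t Ed => // _ Ed [_ -> ->]; rewrite Ed set11.
  have tc : typ LT K (crossK K g) = typ LT K g.
    by rewrite typ_crossK; case: (typ LT K g) t.
  have := len_upK dg; have := len_upK dg'; rewrite tc.
  by case: (typ LT K g) t => // _; lia.
have dn_case : match typ LT K g with T1r2 | T2r22 => True | _ => False end ->
    ellP (crossK K g) = ellP g.
  move=> t; have := card_cayley LT K g; rewrite (no_up _ t) add0r.
  have -> : tvalues (typ LT K g) = 1%N by case: (typ LT K g) t.
  move/eqP/cards1P => [d Ed].
  have dg : g \in upK LT K d by rewrite mem_upK /dnK Ed set11.
  have dg' : crossK K g \in upK LT K d.
    rewrite mem_upK /dnK; have := cross_r2 LT K g.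
    by case: (typ LT K g) t Ed => // _ Ed [_ -> ->]; rewrite Ed set11.
  by have := len_upK dg; have := len_upK dg'; lia.
by move: up_case dn_case; case: (typ LT K g) => // upc dnc t;
   first [exact: upc | exact: dnc].
Qed.

End Matrix.

(** * The columns of That on the basis ahat *)

(** [hdiag t], [hcross t], [hdn t] and [hup t] are the coefficients of P(g),
    P(w x g), the P of the down-transforms and the P of the up-transforms in
    the ahat_g coordinate of That (sum P(d) ahat_d), when g has type t. *)
Definition hdiag t : laurent := vX (- (tdigit t)%:Z) * (cdiag t + 1).

Definition hcross t : laurent :=
  match t with
  | T1Cp | T2Cp | T3Cp | T1Cm | T2Cm | T3Cm => 1
  | T1i1 | T2i11 => vX (- (tdigit t)%:Z)
  | T1r2 | T2r22 => - vX (- (tdigit t)%:Z)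
  | _ => 0
  end.

Definition hdn (t : lvtype) : laurent :=
  match t with
  | T1r1f | T1r2 | T2r11 | T2r21 | T2r22 => 1
  | T2Cr | T3Cr | T3r => vX 1 + vX (- 1%:Z)
  | _ => 0
  end.

Definition hup (t : lvtype) : laurent :=
  match t with
  | T1i1 | T1i2f => 1 - vX (- 2%:Z)
  | T2i11 | T2i12 | T2i22 => 1 - vX (- 4%:Z)
  | T2Ci => vX 1 - vX (- 1%:Z)
  | T3Ci | T3i => vX 1 - vX (- 3%:Z)
  | _ => 0
  end.

Section Column.
Variables (RD : rootDatum) (LD : lvData RD) (LT : lvTypes LD).
Variable LM : lvModule LT.
Implicit Types (K : sbar LD) (g d : fixparam LD).

Definition hentry K d g : laurent :=
  vX ((ellP g)%:Z - (ellP d)%:Z - (ellK K)%:Z) * (entry LM K d g + (g == d)%:R).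

Lemma hcross_entry K g :
  vX ((ellP g)%:Z - (ellP (crossK K g))%:Z - (ellK K)%:Z)
    * ccross (typ LT K (crossK K g)) = hcross (typ LT K g).
Proof.
rewrite (ellK_typ LT K g).
case: (boolP (tcrosses (typ LT K g))) => c; last first.
  have -> : hcross (typ LT K g) = 0 by case: (typ LT K g) c.
  case: (boolP (tcrosses (typ LT K (crossK K g)))) => c'.
    have := typ_crossK c'; rewrite (crossK_invol LT) => E.
    by move: c c'; rewrite E; case: (typ LT K (crossK K g)).
  by case: (typ LT K (crossK K g)) c' => //; rewrite mulr0.
have tc := typ_crossK c; rewrite tc.
have lm : is_Cm (typ LT K g) -> _ := @len_Cm _ _ _ LM K g.
have lp := @len_Cm _ _ _ LM K (crossK K g).
rewrite (crossK_invol LT) tc in lp.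
have ls := @len_same _ _ _ LM K g.
case: (typ LT K g) c lm lp ls => //= _ lm lp ls;
  rewrite ?(ls I) ?subrr ?sub0r ?mulrN1 ?mulr1 // ?u_exp -?vXD -?vX0;
  try (congr vX); try (have := lm isT); try (have := lp isT); lia.
Qed.

Lemma hdn_entry K d g : d \in dnK LT K g ->
  vX ((ellP g)%:Z - (ellP d)%:Z - (ellK K)%:Z) * cup (typ LT K d)
  = hdn (typ LT K g).
Proof.
rewrite -mem_upK (ellK_typ LT K d) => dg; rewrite (len_upK LM dg).
move: (upK_match dg).
by case: (typ LT K d) (typ LT K g) => [] // [] //= _;
  rewrite ?mulr1 ?mulrDr ?mulr1 /u -?vXD -?vX0; congr (_ + _) || congr vX.
Qed.

Lemma hup_entry K d g : d \in upK LT K g ->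
  vX ((ellP g)%:Z - (ellP d)%:Z - (ellK K)%:Z) * cdn (typ LT K d)
  = hup (typ LT K g).
Proof.
rewrite (ellK_typ LT K g) => dg.
have -> : (ellP g)%:Z - (ellP d)%:Z
    = - ((tdigit (typ LT K g))%:Z - (tdefect (typ LT K g))%:Z).
  by rewrite -(len_upK LM dg) opprB.
move: (upK_match dg).
by case: (typ LT K g) (typ LT K d) => [] // [] //= _;
  rewrite mulrBr ?mulr1 ?u_exp /u -?vXD -?vX0.
Qed.

(** Transposing [entry_row]: each of its conditions on g relative to d is
    symmetric, being the mirrored condition on d relative to g, and then the
    type of g determines the coefficient. *)
Lemma hentryE K d g :
  hentry K d g = hdiag (typ LT K g) * (d == g)%:R
    + hcross (typ LT K g) * (d == crossK K g)%:R
    + hdn (typ LT K g) * (eps LT K g d * (d \in dnK LT K g)%:R)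
    + hup (typ LT K g) * (eps LT K d g * (d \in upK LT K g)%:R).
Proof.
rewrite /hentry entry_row /row_entry (eq_sym g d) (eq_crossK LT).
rewrite -mem_upK [g \in upK _ _ _]mem_upK; set V := vX _.
have -> a b c e (i j k l : laurent) :
    V * (a * i + b * j + c * k + e * l + i)
    = V * (a + 1) * i + V * b * j + V * c * k + V * e * l by ring.
have add4 (a b c e a' b' c' e' : laurent) :
  a = a' -> b = b' -> c = c' -> e = e' -> a + b + c + e = a' + b' + c' + e'.
  by move=> -> -> -> ->.
apply: add4.
- case: eqP => [dg|_]; rewrite ?mulr0 //; congr (_ * _).
  by rewrite /V dg subrr sub0r (ellK_typ LT K g).
- by case: eqP => [dg|_]; rewrite ?mulr0 // /V dg hcross_entry.
- by case: (boolP (d \in _)) => [/hdn_entry <-|_] //; rewrite ?mulr0.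
- by case: (boolP (d \in _)) => [/hup_entry <-|_] //; rewrite ?mulr0.
Qed.

Definition hatT K (x : fixparam LD -> laurent) g : laurent :=
  let t := typ LT K g in
  hdiag t * x g + hcross t * x (crossK K g)
  + hdn t * (\sum_(d in dnK LT K g) eps LT K g d * x d)
  + hup t * (\sum_(d in upK LT K g) eps LT K d g * x d).

Lemma acoef_That K (x : fixparam LD -> laurent) g :
  vX (ellP g)%:Z * acoef (That LM K (\sum_d x d *: ahat d)) g = hatT K x g.
Proof.
have pick (y : laurent) e : \sum_d y * (d == e)%:R * x d = y * x e.
  rewrite (bigD1 e) //= eqxx mulr1 big1 ?addr0 // => d /negPf ->.
  by rewrite mulr0 mul0r.
have pickA (A : {set fixparam LD}) (y : laurent) (c : fixparam LD -> laurent) :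
    \sum_d y * (c d * (d \in A)%:R) * x d = y * \sum_(d in A) c d * x d.
  rewrite mulr_sumr [RHS]big_mkcond /=; apply: eq_bigr => d _.
  by case: (d \in A); rewrite ?mulr1 ?mulr0 ?mul0r // mulrA.
transitivity (\sum_d hentry K d g * x d).
  rewrite /That acoefZ acoefD linear_sum !acoef_sum -big_split /= !mulr_sumr.
  apply: eq_bigr => d _; rewrite linearZ /= linearZ /= !acoefZ acoef_abas.
  rewrite /hentry /entry !vXD; by ring.
under eq_bigr => d _ do rewrite hentryE !mulrDl.
by rewrite !big_split /= !pick !pickA.
Qed.

Lemma acoef_Chat (LC : lvCanonical LM) (A : pred (fixparam LD)) m g :
  vX (ellP g)%:Z * acoef (\sum_(d | A d) m d *: Chat LC d) g
  = \sum_(d | A d) Phat LC g d * m d.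
Proof.
rewrite acoef_sum mulr_sumr; apply: eq_bigr => d _.
rewrite acoefZ ChatE acoef_sum (bigD1 g) //= big1 => [|e /negPf ne].
  rewrite addr0 !acoefZ acoef_abas eqxx mulr1.
  set a := (ellP g)%:Z; have e : vX a * vX (- a) = 1 by rewrite -vXD subrr vX0.
  rewrite -[RHS]mulr1 -e; by ring.
by rewrite !acoefZ acoef_abas eq_sym ne !mulr0.
Qed.

End Column.

(** * The vanishing of m(d,l) *)

Section Inert.
Variables (RD : rootDatum) (LD : lvData RD) (LT : lvTypes LD).
Variables (LM : lvModule LT) (LC : lvCanonical LM).
Variables (K : sbar LD) (l : fixparam LD).

(** The types of ascents at which T acts by -1. *)
Definition inert (t : lvtype) : bool :=
  match t with T1i2s | T1rn | T2rn | T3rn => true | _ => false end.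

Hypothesis hl : inert (typ LT K l).

Let x d := Phat LC d l.

Lemma inert_asc : ~~ desc LT K l.
Proof. by rewrite /desc; case: (typ LT K l) hl. Qed.

Lemma hatT_Chat g :
  hatT LT K x g = \sum_(d | desc LT K d) Phat LC g d * mK LC K d l.
Proof.
by rewrite -(acoef_That LM) -acoef_Chat -(mKE LC inert_asc) ChatE.
Qed.

(** Here d is a descent not below l. The cross and Cayley transforms of d are
    never of inert type, so they differ from l and their P has negative degrees
    only; the coefficients multiplying them are 1, -v^-k, or v + v^-1 for the
    down-transform in defect 1. *)
Lemma hatT_descent_coef d (j : int) : desc LT K d -> ~~ plt LC d l -> 0 <= j ->
  lcoef (hatT LT K x d) j
  = if (j == 0) && (defect LT K d == 1%N) then \sum_(e in dnK LT K d) mu1 LC e l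
    else 0.
Proof.
move=> dd npl j0.
have neql e : ~~ inert (typ LT K e) -> neg_laurent (x e).
  move=> ne; apply: Phat_neg; apply: contraNneq ne => ->; exact: hl.
have x0 : x d = 0.
  apply: contraNeq npl => /Phat_le le; rewrite /plt le andbT.
  by apply: contraTneq dd => ->; exact: inert_asc.
have ncross : neg_laurent (hcross (typ LT K d) * x (crossK K d)).
  case: (boolP (tcrosses (typ LT K d))) => c; last first.
    have -> : hcross (typ LT K d) = 0 by case: (typ LT K d) c.
    rewrite mul0r; exact: neg_laurent0.
  have /neql xn : ~~ inert (typ LT K (crossK K d)).
    by rewrite typ_crossK //; case: (typ LT K d) c.
  case: (typ LT K d) c => //= _; rewrite ?mul1r ?mulNr //;
  by [exact: neg_laurent_vXM | exact/neg_laurentN/neg_laurent_vXM].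
have ndn : neg_laurent (\sum_(e in dnK LT K d) eps LT K d e * x e).
  apply: neg_laurent_sum => e; rewrite -mem_upK => /upK_match m.
  have /neql xn : ~~ inert (typ LT K e) by case: (typ LT K e) m.
  rewrite /eps; case: ifP => _; rewrite ?mulN1r ?mul1r //.
  exact: neg_laurentN.
have -> : hatT LT K x d = hcross (typ LT K d) * x (crossK K d)
    + hdn (typ LT K d) * \sum_(e in dnK LT K d) eps LT K d e * x e.
  rewrite /hatT x0 mulr0 add0r.
  have -> : hup (typ LT K d) = 0 by move: dd; rewrite /desc; case: (typ LT K d).
  by rewrite mul0r addr0.
rewrite lcoefD ncross // add0r.
case: (boolP (defect LT K d == 1%N)) => df; last first.
  rewrite andbF; move: df dd; rewrite /defect /desc.
  by case: (typ LT K d) => //= _ _; rewrite ?mul1r ?mul0r ?lcoef0 ?ndn.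
have n21 : typ LT K d <> T2r21 by move=> E; move: df; rewrite /defect E.
have -> : hdn (typ LT K d) = vX 1 + vX (- 1%:Z).
  by move: df dd; rewrite /defect /desc; case: (typ LT K d).
rewrite mulrDl lcoefD !lcoef_vXM opprK (ndn (j + 1)) ?addr0; last by lia.
rewrite andbT; case: eqP => [->|jn]; last by rewrite ndn //; lia.
rewrite lcoef_sum; apply: eq_bigr => e _.
by rewrite eps_not_r21 // mul1r.
Qed.

(** In the coefficient of ahat_d, the terms P(d,e) m(e,l) with e <> d have
    negative degrees only: by induction on the longer e, the factor m(e,l) has
    no positive degrees. *)
Lemma mK_nonneg d : desc LT K d -> ~~ plt LC d l ->
  forall j : int, 0 <= j -> lcoef (mK LC K d l) j = lcoef (hatT LT K x d) j.
Proof.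
pose M := \max_(e : fixparam LD) ellP e.
have [n] := ubnP (M - ellP d)%N; elim: n d => // n IHn d ltn dd npl j j0.
suff tail : neg_laurent (\sum_(e | desc LT K e && (e != d))
                          Phat LC d e * mK LC K e l).
  by rewrite hatT_Chat (bigD1 d) //= Phat_diag mul1r lcoefD tail // addr0.
apply: neg_laurent_sum => e /andP[de ed].
have [->|P0] := eqVneq (Phat LC d e) 0.
  by rewrite mul0r; exact: neg_laurent0.
have le_de := Phat_le P0.
have npe : ~~ plt LC e l.
  apply: contra npl => /andP[_ le_el].
  rewrite /plt (ple_trans le_de le_el) andbT.
  by apply: contraTneq dd => ->; exact: inert_asc.
have lt_de : (ellP d < ellP e)%N by apply: (ple_len le_de); rewrite eq_sym.
have le_M : (ellP e <= M)%N by exact: leq_bigmax.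
apply: neg_laurentM; first by apply: Phat_neg; rewrite eq_sym.
move=> i i0; rewrite IHn //; [|by lia|by lia].
by rewrite hatT_descent_coef // ?(gt_eqF i0) //; lia.
Qed.

Lemma mK_prec d : desc LT K d -> ~~ prec LC K d l -> mK LC K d l = 0.
Proof.
move=> dd npr; have npl : ~~ plt LC d l.
  by apply: contra npr; rewrite /prec => ->.
apply: bar_nonpos_eq0.
- exact: (mK_bar LC inert_asc dd).
- by move=> j j0; rewrite mK_nonneg ?hatT_descent_coef ?(gt_eqF j0) //; lia.
rewrite mK_nonneg // hatT_descent_coef // eqxx /=.
case: ifP => // df; apply: big1 => e ed; apply/eqP.
apply: contraNT npr => mu; rewrite /prec df npl /=.
by apply/orP; right; apply/orP; left; apply/existsP; exists e; rewrite ed.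
Qed.

Lemma Uhat_hatT g : Uhat LC K g l = hatT LT K x g.
Proof.
rewrite hatT_Chat /Uhat [RHS](bigID (fun d => prec LC K d l)) /=.
rewrite [X in _ + X]big1 ?addr0 // => d /andP[dd npr].
by rewrite mK_prec ?mulr0.
Qed.

End Inert.

(** * The identities for P(g,l) *)

Theorem lemma11p5 (RD : rootDatum) (LD : lvData RD) (LT : lvTypes LD)
    (LM : lvModule LT) (LC : lvCanonical LM)
    (K : sbar LD) (l g : fixparam LD)
    (hl : typ LT K l = T1i2s \/ typ LT K l = T1rn \/
          typ LT K l = T2rn \/ typ LT K l = T3rn) :
  let v := vQ in
  let P := fun d : fixparam LD => lval (Phat LC d l) in
  let U := lval (Uhat LC K g l) in
  let Pcross := P (crossK K g) in
  let Pup := \sum_(d in upK LT K g) P d in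
  match typ LT K g with
  | T1Cp => P g = - v * Pcross + v * U
  | T1i1 => P g + Pcross = - (v - v^-1) * Pup + v * U
  | T1i2f => P g = - 2^-1 * (v - v^-1) * Pup + 2^-1 * v * U
  | T2Cp => P g = - v ^+ 2 * Pcross + v ^+ 2 * U
  | T2Ci => (v + v^-1) * P g = - v * (v - v^-1) * Pup + v * U
  | T2i11 => P g + Pcross = - (v ^+ 2 - v ^- 2) * Pup + v ^+ 2 * U
  | T2i12 =>
      P g = - 2^-1 * (v ^+ 2 - v ^- 2) *
              (\sum_(g' | arrow LT (T LM) K g' g) lval (eps LT K g' g) * P g')
            + 2^-1 * v ^+ 2 * U
  | T2i22 => P g = - 2^-1 * (v ^+ 2 - v ^- 2) * Pup + 2^-1 * v ^+ 2 * U
  | T3Cp => P g = - v ^+ 3 * Pcross + v ^+ 3 * U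
  | T3Ci | T3i =>
      (v + v^-1) * P g = - v * (v ^+ 2 - v ^- 2) * Pup + v ^+ 2 * U
  | T1r1s | T1ic => (v + v^-1) * P g = U
  | T2ic => (v ^+ 2 + v ^- 2) * P g = U
  | T3ic => (v ^+ 3 + v ^- 3) * P g = U
  | _ => True
  end.
Proof.
have {}hl : inert (typ LT K l) by case: hl => [|[|[|]]] ->.
move=> v P U Pcross Pup.
have v0 : v != 0 := vQ_neq0.
have two0 : (2 : Qv) != 0.
  rewrite -[2%:R](rmorph_nat (@tofrac {poly int})) tofrac_eq0.
  by rewrite -polyC_natr polyC_eq0.
(* The signs in [Pupe] are all 1 except possibly at type 2i12, where the
   up-transforms of g are the sources of the arrows to g. *)
pose Pupe := \sum_(d in upK LT K g) lval (eps LT K d g) * P d.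
have UE : U = lval (hdiag (typ LT K g)) * P g
    + lval (hcross (typ LT K g)) * Pcross
    + lval (hdn (typ LT K g))
        * lval (\sum_(d in dnK LT K g) eps LT K g d * Phat LC d l)
    + lval (hup (typ LT K g)) * Pupe.
  rewrite /U (Uhat_hatT LC hl) /hatT !rmorphD !rmorphM /Pupe; congr (_ + _ * _).
  by rewrite rmorph_sum; apply: eq_bigr => d _; rewrite rmorphM.
have arrE : typ LT K g = T2i12 ->
    \sum_(g' | arrow LT (T LM) K g' g) lval (eps LT K g' g) * P g' = Pupe.
  by move=> E; apply: eq_bigl => d; rewrite arrow_i12.
have upE : typ LT K g <> T2i12 -> Pupe = Pup.
  move=> n; apply: eq_bigr => d dg; rewrite eps_not_r21 ?rmorph1 ?mul1r //.
  by move=> E; move: (upK_match dg); rewrite E; case: (typ LT K g) n.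
move: UE arrE upE.
have lvX1 : lval (vX 1) = v by [].
case: (typ LT K g) => UE arrE upE //;
  rewrite ?(arrE erefl) UE; try (rewrite upE; last by []).
all: rewrite /hdiag /hcross /hup /hdn /cdiag /tdigit.
all: rewrite ?(lvalE, lval_vXN, lval_u, lvX1).
all: rewrite -?/v.
(* Each goal is a field identity in P(g), Pcross, the sums and v; abstracting
   from the field of fractions of Z[v] keeps the comparison of atoms cheap. *)
all: set y := lval (\sum_(d in dnK LT K g) _).
all: move: (P g) (Pcross) (Pup) (Pupe) (y) => p c s s' z.
all: move: v0 two0; generalize (v : Qv); move: p c s s' z; clear.
all: by move: Qv => F p c s s' z w w0 two0; field; rewrite ?w0 ?two0.
Qed.
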